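(* Let $f:\mathbb{R}^n\to\mathbb{R}\cup\{+\infty\}$ and $g:\mathbb{R}^p\to\mathbb{R}\cup\{+\infty\}$ be proper lower semicontinuous convex functions, $A\in\mathbb{R}^{m\times n}$, $B\in\mathbb{R}^{m\times p}$, $b\in\mathbb{R}^m$, $\eta>0$, and let $L(x,y,\lambda)=f(x)+g(y)-\lambda^T(Ax+By-b)$. Let $z^k=(y^k,x^k,\lambda^k)$ be generated from an initial point $(x^0,\lambda^0)$ (and arbitrary $y^0$) by the alternating direction method of multipliers (ADMM): for $k\ge0$, $$y^{k+1}\in\arg\min_y\Big\{g(y)-\langle B^T\lambda^k,y\rangle+\tfrac\eta2\|Ax^k+By-b\|_2^2\Big\},$$ $$\lambda^{k+1}=\lambda^k-\eta(Ax^k+By^{k+1}-b),$$ $$x^{k+1}\in\arg\min_x\Big\{f(x)-\langle A^T\lambda^{k+1},x\rangle+\tfrac\eta2\|Ax+By^{k+1}-b\|_2^2\Big\}.$$ Set $\bar z^k=(\bar y^k,\bar x^k,\bar\lambda^k)=\frac1k\sum_{i=1}^kz^i$ and $$P=\begin{pmatrix}0&0&0\\0&\eta A^TA&-A^T\\0&-A&\frac1\eta I\end{pmatrix}.$$ Then: (1) for every $k\ge1$ and every $z=(y,x,\lambda)\in\mathbb{R}^p\times\mathbb{R}^n\times\mathbb{R}^m$, $$L(\bar x^k,\bar y^k,\lambda)-L(x,y,\bar\lambda^k)\le\frac{\|z-z^0\|_P^2}{2k};$$ (2) if $(x^*,y^* )$ is an optimal solution of the problem $\min_{x,y}\{f(x)+g(y):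 Ax+By=b\}$ and $F^*=f(x^* )+g(y^* )$ is its optimal value, then for every $k\ge1$ and every $\lambda\in\mathbb{R}^m$, $$f(\bar x^k)+g(\bar y^k)-\lambda^T(A\bar x^k+B\bar y^k-b)-F^*\le\frac{\|(y^*,x^*,\lambda)-(y^0,x^0,\lambda^0)\|_P^2}{2k}.$$
   Context: $\|z\|_P^2=z^TPz$, with blocks of $P$ ordered as $(y,x,\lambda)$. The minimizers in the ADMM updates are assumed to exist (any minimizer may be chosen). *)

(* Defs.v *)
From HB Require Import structures.
From mathcomp Require Import all_boot all_order all_algebra.
From mathcomp Require Import all_classical all_reals all_analysis.
Set Implicit Arguments.
Unset Strict Implicit.
Unset Printing Implicit Defensive.
Import Order.TTheory GRing.Theory Num.Theory.
Import numFieldNormedType.Exports.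
Local Open Scope classical_set_scope.
Local Open Scope ring_scope.

(* Functions with values in R \cup {+oo} are functions to \bar R that never
   take the value -oo; this is part of [proper_efun]. *)
Definition proper_efun (R : realType) (T : Type) (f : T -> \bar R) : Prop :=
  (forall x, f x != -oo%E) /\ (exists x, f x != +oo%E).

(* The library's [convex_function] is for real-valued functions only.  Since
   0 * +oo = 0 in \bar R, the cases t = 0 and t = 1 hold trivially. *)
Definition econvex (R : realType) (E : lmodType R) (f : E -> \bar R) : Prop :=
  forall (x y : E) (t : R), 0 <= t <= 1 ->
    (f (t *: x + (1 - t) *: y)%R <= t%:E * f x + (1 - t)%:E * f y)%E.

Definition dot (R : realType) (n : nat) (u v : 'cV[R]_n) : R :=
  (u^T *m v) 0 0.

(* The library norm on matrices is the sup norm, hence this definition of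
   the squared Euclidean norm. *)
Definition sqnorm2 (R : realType) (n : nat) (u : 'cV[R]_n) : R := dot u u.

Definition is_argmin (R : realType) (T : Type) (D : set T) (h : T -> \bar R)
    (x : T) : Prop :=
  D x /\ (forall u, D u -> (h x <= h u)%E).

Definition Lagrangian (R : realType) (n p m : nat)
    (f : 'cV[R]_n -> \bar R) (g : 'cV[R]_p -> \bar R)
    (A : 'M[R]_(m, n)) (B : 'M[R]_(m, p)) (b : 'cV[R]_m)
    (x : 'cV[R]_n) (y : 'cV[R]_p) (l : 'cV[R]_m) : \bar R :=
  (f x + g y - (dot l (A *m x + B *m y - b))%:E)%E.

Definition ADMM (R : realType) (n p m : nat)
    (f : 'cV[R]_n -> \bar R) (g : 'cV[R]_p -> \bar R)
    (A : 'M[R]_(m, n)) (B : 'M[R]_(m, p)) (b : 'cV[R]_m) (eta : R)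
    (x : nat -> 'cV[R]_n) (y : nat -> 'cV[R]_p) (l : nat -> 'cV[R]_m) : Prop :=
  forall k : nat,
  [/\ is_argmin setT
        (fun v => g v - (dot (B^T *m l k) v)%:E
                  + (eta / 2 * sqnorm2 (A *m x k + B *m v - b))%:E)%E
        (y k.+1),
      l k.+1 = l k - eta *: (A *m x k + B *m y k.+1 - b)
    & is_argmin setT
        (fun u => f u - (dot (A^T *m l k.+1) u)%:E
                  + (eta / 2 * sqnorm2 (A *m u + B *m y k.+1 - b))%:E)%E
        (x k.+1)].

(* The average of u 1, ..., u k; the initial point u 0 is not included. *)
Definition ergodic_mean (R : realType) (n : nat) (u : nat -> 'cV[R]_n) (k : nat) :
    'cV[R]_n :=
  k%:R^-1 *: \sum_(1 <= i < k.+1) u i.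

Definition zvec (R : realType) (n p m : nat)
    (y : 'cV[R]_p) (x : 'cV[R]_n) (l : 'cV[R]_m) : 'cV[R]_(p + (n + m)) :=
  col_mx y (col_mx x l).

Definition Pmx (R : realType) (n p m : nat) (A : 'M[R]_(m, n)) (eta : R) :
    'M[R]_(p + (n + m)) :=
  block_mx 0 0
           0 (block_mx (eta *: (A^T *m A)) (- A^T)
                       (- A)               (eta^-1)%:M).

Definition sqnormP (R : realType) (N : nat) (P : 'M[R]_N) (z : 'cV[R]_N) : R :=
  (z^T *m P *m z) 0 0.

(* Main.v *)
Require Import Defs.
From HB Require Import structures.
From mathcomp Require Import all_boot all_order all_algebra.
From mathcomp Require Import all_classical all_reals all_analysis.
From mathcomp Require Import ring lra.
Set Implicit Arguments.
Unset Strict Implicit.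
Unset Printing Implicit Defensive.
Import Order.TTheory GRing.Theory Num.Theory.
Import numFieldNormedType.Exports.
Local Open Scope classical_set_scope.
Local Open Scope ring_scope.

(** P factors as eta C^T C, so the seminorm of a triple (y, x, l) is
eta |w|^2 for the reduced variable w = A x - l / eta, which lives in the space
of multipliers (sqnormP_zvec, reduced).  In this variable one iteration is very
simple.  Write w and w+ for its values before and after the iteration, and w'
for its value at the reference point.  The multiplier update says that the
residual A x+ + B y+ - b is w+ - w (residualE).  The optimality conditions of
the two minimizations say that B^T l+ and A^T (l+ - eta (w+ - w)) are
subgradients of g at y+ and of f at x+ (argmin_subgradient).  Adding the two
subgradient inequalities, everything cancels in the Lagrangian gap except
- eta <w+ - w', w+ - w>, and the three-point identity gives
gap <= eta / 2 (|w - w'|^2 - |w+ - w'|^2) (lagrangian_step).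

These bounds telescope when summed over the iterations.  The Lagrangian is
convex in (x, y) and affine in the multiplier, so that Jensen's inequality
(econvex_ergodic_mean) passes from the mean of the gaps to the gap at the means
(lagrangian_ergodic_gap).  The second claim is the first one at (x*, y*, l'):
feasibility makes the Lagrangian there equal to the optimal value, whatever
the multiplier.

All iterates after the initial point have finite objective values
(admm_fin_num).  Hence the algebra takes place in the reals, and a reference
point with an infinite objective value makes the left-hand side equal to
-oo. *)

(** * The dot product *)

Section Dot.
Variable R : realType.

Lemma dotC n (u v : 'cV[R]_n) : dot u v = dot v u.
Proof. by rewrite /dot !mxE; apply: eq_bigr => i _; rewrite !mxE mulrC. Qed.

Lemma dotDr n (u v w : 'cV[R]_n) : dot u (v + w) = dot u v + dot u w.
Proof. by rewrite /dot mulmxDr mxE. Qed.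

Lemma dotNr n (u v : 'cV[R]_n) : dot u (- v) = - dot u v.
Proof. by rewrite /dot mulmxN mxE. Qed.

Lemma dotZr n (a : R) (u v : 'cV[R]_n) : dot u (a *: v) = a * dot u v.
Proof. by rewrite /dot -scalemxAr mxE. Qed.

Lemma dotDl n (u v w : 'cV[R]_n) : dot (u + v) w = dot u w + dot v w.
Proof. by rewrite dotC dotDr !(dotC w). Qed.

Lemma dotNl n (u v : 'cV[R]_n) : dot (- u) v = - dot u v.
Proof. by rewrite dotC dotNr dotC. Qed.

Lemma dotZl n (a : R) (u v : 'cV[R]_n) : dot (a *: u) v = a * dot u v.
Proof. by rewrite dotC dotZr dotC. Qed.

Definition dotE := (dotDl, dotDr, dotNl, dotNr, dotZl, dotZr).

Lemma dot0r n (u : 'cV[R]_n) : dot u 0 = 0.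
Proof. by rewrite /dot mulmx0 mxE. Qed.

Lemma dot_sumr n (I : Type) (s : seq I) (P : pred I) (u : 'cV[R]_n)
    (v : I -> 'cV[R]_n) :
  dot u (\sum_(i <- s | P i) v i) = \sum_(i <- s | P i) dot u (v i).
Proof. exact: (big_morph _ (dotDr u) (dot0r u)). Qed.

Lemma dot_trmx n m (A : 'M[R]_(m, n)) (u : 'cV[R]_m) (v : 'cV[R]_n) :
  dot (A^T *m u) v = dot u (A *m v).
Proof. by rewrite /dot trmx_mul trmxK mulmxA. Qed.

Lemma sqnorm2_ge0 n (u : 'cV[R]_n) : 0 <= sqnorm2 u.
Proof.
by rewrite /sqnorm2 /dot mxE sumr_ge0// => i _; rewrite mxE -expr2 sqr_ge0.
Qed.

End Dot.

(** * The seminorm of P *)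

(** This is the factorization P = eta C^T C with C = (0, A, - eta^-1 I); in
particular P is positive semidefinite if eta > 0. *)
Lemma sqnormP_zvec (R : realType) (n p m : nat) (A : 'M[R]_(m, n)) (eta : R)
    (y y0 : 'cV[R]_p) (x x0 : 'cV[R]_n) (l l0 : 'cV[R]_m) : eta != 0 ->
  sqnormP (Pmx p A eta) (zvec y x l - zvec y0 x0 l0) =
  eta * sqnorm2 ((A *m x - eta^-1 *: l) - (A *m x0 - eta^-1 *: l0)).
Proof.
move=> eta0.
have -> : A *m x - eta^-1 *: l - (A *m x0 - eta^-1 *: l0) =
    A *m (x - x0) - eta^-1 *: (l - l0).
  by rewrite mulmxBr scalerBr !opprD !opprK addrACA.
rewrite /zvec !opp_col_mx !add_col_mx.
move: (y - y0) (x - x0) (l - l0) => {y0 x0 l0}y {}x {}l.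
rewrite /sqnormP /Pmx !tr_col_mx mul_row_block mul_row_col !mulmx0 !add0r.
rewrite mul0mx add0r mul_row_block mul_row_col mul_mx_scalar.
rewrite -scalemxAr !mulmxDl -!scalemxAl !mulmxN !mulNmx.
have dotP q (u v : 'cV[R]_q) : (u^T *m v) 0 0 = dot u v by [].
have addE (X Y : 'M[R]_1) : (X + Y) 0 0 = X 0 0 + Y 0 0 by rewrite mxE.
have oppE (X : 'M[R]_1) : (- X) 0 0 = - X 0 0 by rewrite mxE.
have scaleE a (X : 'M[R]_1) : (a *: X) 0 0 = a * X 0 0 by rewrite mxE.
rewrite !(addE, oppE, scaleE) -!mulmxA !dotP.
rewrite [dot x (A^T *m _)]dotC dot_trmx.
rewrite [dot x (A^T *m l)]dotC dot_trmx.
rewrite /sqnorm2 !dotE (dotC (A *m x) l).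
by field.
Qed.

(** * First-order optimality *)

(** If a < 0, then t = a / (a - c) lies in ]0, 1] and the quadratic takes the
negative value t^2 a there. *)
Lemma linear_term_ge0 (R : realFieldType) (a c : R) : 0 <= c ->
  (forall t, 0 <= t <= 1 -> 0 <= t * a + t ^+ 2 * c) -> 0 <= a.
Proof.
move=> c0 ac; rewrite leNgt; apply/negP => a0.
have d0 : a - c < 0 by lra.
have t0 : 0 < a / (a - c) by rewrite nmulr_rgt0 // invr_lt0.
have t1 : a / (a - c) <= 1 by rewrite ler_ndivrMr //; lra.
have := ac (a / (a - c)); rewrite (ltW t0) t1 => /(_ isT).
have -> : a / (a - c) * a + (a / (a - c)) ^+ 2 * c =
    (a / (a - c)) ^+ 2 * a by field; rewrite lt_eqF.
by rewrite leNgt nmulr_llt0 ?exprn_gt0.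
Qed.

Section Optimality.
Variables (R : realType) (q m : nat) (h : 'cV[R]_q -> \bar R).
Hypotheses (h_proper : proper_efun h) (h_convex : econvex h).

Lemma argmin_fin_num (a b : 'cV[R]_q -> R) (v : 'cV[R]_q) :
  is_argmin setT (fun u => h u - (a u)%:E + (b u)%:E)%E v ->
  h v \is a fin_num.
Proof.
case: h_proper => hN [u hu] [_ /(_ u I)] hvu.
rewrite fin_numE hN /=; apply/eqP => hv; move: hvu; rewrite hv.
by have := hN u; move: hu; case: (h u).
Qed.

Variables (M : 'M[R]_(m, q)) (mu c : 'cV[R]_m) (eta : R).
Hypothesis eta_ge0 : 0 <= eta.

(** The objective is compared with its value at v + t (u - v): convexity of h
bounds the change by a linear term in t plus the quadratic term of the
penalty, so the linear term is nonnegative. *)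
Lemma argmin_subgradient (rho : 'cV[R]_q -> 'cV[R]_m) (v : 'cV[R]_q) :
  (forall u, rho u = M *m u + c) ->
  is_argmin setT (fun u => h u - (dot (M^T *m mu) u)%:E
                           + (eta / 2 * sqnorm2 (rho u))%:E)%E v ->
  forall u, (h v + (dot (mu - eta *: rho v) (M *m (u - v)))%:E <= h u)%E.
Proof.
move=> rhoE vmin u; have := argmin_fin_num vmin.
case hv : (h v) => [hv'| |] // _.
case hu : (h u) => [hu'| |]; last 2 first.
- by rewrite leey.
- by case: h_proper => /(_ u); rewrite hu.
rewrite -EFinD lee_fin -subr_ge0.
apply: (@linear_term_ge0 _ _ (eta / 2 * sqnorm2 (M *m (u - v)))).
  by rewrite mulr_ge0 ?divr_ge0 ?sqnorm2_ge0.
move=> t t01.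
have := h_convex u v t01; rewrite hu hv -!EFinM -EFinD => ht.
case: vmin => _ /(_ (t *: u + (1 - t) *: v) I); rewrite hv.
have : h (t *: u + (1 - t) *: v) != -oo%E by case: h_proper.
case: (h _) ht => [s| |] //; rewrite -!EFinB -!EFinD !lee_fin => hs _.
have -> : t *: u + (1 - t) *: v = v + t *: (u - v).
  by rewrite scalerBl scale1r scalerBr addrCA.
have -> : rho (v + t *: (u - v)) = rho v + t *: (M *m (u - v)).
  by rewrite !rhoE mulmxDr -scalemxAr addrAC.
rewrite !dot_trmx mulmxDr -scalemxAr /sqnorm2 !dotE.
rewrite (dotC (M *m (u - v)) (rho v)).
move: (dot _ _) (dot _ _) (dot _ _) (dot _ _) => d1 d2 d3 d4.
nra.
Qed.

End Optimality.

(** * Ergodic means *)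

Section ErgodicMean.
Variable R : realType.

Lemma ergodic_mean_mul n m (A : 'M[R]_(m, n)) (u : nat -> 'cV[R]_n) k :
  A *m ergodic_mean u k = ergodic_mean (fun i => A *m u i) k.
Proof. by rewrite /ergodic_mean -scalemxAr mulmx_sumr. Qed.

Lemma ergodic_meanD n (u v : nat -> 'cV[R]_n) k :
  ergodic_mean u k + ergodic_mean v k = ergodic_mean (fun i => u i + v i) k.
Proof. by rewrite /ergodic_mean big_split scalerDr. Qed.

Lemma ergodic_mean_cst n (u : 'cV[R]_n) k : (0 < k)%N ->
  ergodic_mean (fun=> u) k = u.
Proof.
move=> k0; rewrite /ergodic_mean sumr_const_nat subn1 -scalerMnr scalerMnl.
by rewrite -mulr_natr mulVf ?scale1r // pnatr_eq0 -lt0n.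
Qed.

Lemma dot_ergodic_mean n (u : 'cV[R]_n) (v : nat -> 'cV[R]_n) k :
  dot u (ergodic_mean v k) = k%:R^-1 * \sum_(1 <= i < k.+1) dot u (v i).
Proof. by rewrite /ergodic_mean dotZr dot_sumr. Qed.

(** Jensen's inequality, by induction from
mean (k + 1) = k / (k + 1) mean k + 1 / (k + 1) u (k + 1). *)
Lemma econvex_ergodic_mean n (f : 'cV[R]_n -> \bar R) (u : nat -> 'cV[R]_n)
    (F : nat -> R) k : econvex f -> (0 < k)%N ->
  (forall i, (0 < i <= k)%N -> (f (u i) <= (F i)%:E)%E) ->
  (f (ergodic_mean u k) <= (k%:R^-1 * \sum_(1 <= i < k.+1) F i)%:E)%E.
Proof.
move=> fc; elim: k => // -[|k] IH _ fF.
  by rewrite /ergodic_mean !big_nat1 invr1 scale1r mul1r fF.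
have k1 : k.+1%:R != 0 :> R by rewrite pnatr_eq0.
have k2 : k.+2%:R != 0 :> R by rewrite pnatr_eq0.
pose t : R := k.+1%:R / k.+2%:R.
have t01 : 0 <= t <= 1.
  by rewrite divr_ge0 //= ler_pdivrMr ?mul1r ?ler_nat ?ltr0n.
have tV : t * k.+1%:R^-1 = k.+2%:R^-1 by rewrite /t mulrAC divff ?mul1r.
have tB : 1 - t = k.+2%:R^-1.
  by rewrite /t -[X in X - _](divff k2) -mulrBl -natrB // subSnn mul1r.
have -> : ergodic_mean u k.+2 = t *: ergodic_mean u k.+1 + (1 - t) *: u k.+2.
  by rewrite /ergodic_mean big_nat_recr //= scalerDr scalerA tV tB.
apply: (le_trans (fc _ _ _ t01)).
rewrite big_nat_recr //= mulrDr -{1}tV -mulrA -tB.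
rewrite [leRHS]EFinD [X in (_ <= X + _)%E]EFinM [X in (_ <= _ + X)%E]EFinM.
case/andP: t01 => t0 t1; apply: leeD.
  apply: lee_wpmul2l; first by rewrite lee_fin.
  by apply: IH => // i /andP[i0 ik]; rewrite fF // i0 leqW.
by apply: lee_wpmul2l; rewrite ?lee_fin ?subr_ge0 // fF /=.
Qed.

End ErgodicMean.

(** * Progress made by one iteration *)

(** The three-point identity is
2 <p - r, p - q> = |p - r|^2 + |p - q|^2 - |q - r|^2. *)
Lemma three_point (R : realType) (n : nat) (p q r : 'cV[R]_n) :
  sqnorm2 (p - r) - sqnorm2 (q - r) <= 2 * dot (p - r) (p - q).
Proof.
rewrite -subr_ge0; have := sqnorm2_ge0 (p - q).
rewrite /sqnorm2 !dotE (dotC q p) (dotC r p) (dotC r q) => h.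
by apply: le_trans h _; rewrite le_eqVlt; apply/orP; left; apply/eqP; ring.
Qed.

Section ADMMStep.
Variables (R : realType) (n p m : nat).
Variables (f : 'cV[R]_n -> \bar R) (g : 'cV[R]_p -> \bar R).
Variables (A : 'M[R]_(m, n)) (B : 'M[R]_(m, p)) (b : 'cV[R]_m) (eta : R).
Variables (x : nat -> 'cV[R]_n) (y : nat -> 'cV[R]_p) (l : nat -> 'cV[R]_m).
Hypotheses (f_proper : proper_efun f) (f_convex : econvex f).
Hypotheses (g_proper : proper_efun g) (g_convex : econvex g).
Hypothesis eta_gt0 : 0 < eta.
Hypothesis admm : ADMM f g A B b eta x y l.

Definition residual (u : 'cV[R]_n) (v : 'cV[R]_p) := A *m u + B *m v - b.

(** Up to the factor eta, the seminorm of P is the Euclidean norm of this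
image of (x, l). *)
Definition reduced (u : 'cV[R]_n) (mu : 'cV[R]_m) := A *m u - eta^-1 *: mu.

Lemma admm_fin_num k : (f (x k.+1) \is a fin_num) * (g (y k.+1) \is a fin_num).
Proof.
by case: (admm k) => /(argmin_fin_num g_proper) ? _
                     /(argmin_fin_num f_proper) ?.
Qed.

(** The multiplier update turns the step of the reduced variable into the
residual. *)
Lemma residualE k : residual (x k.+1) (y k.+1) =
  reduced (x k.+1) (l k.+1) - reduced (x k) (l k).
Proof.
case: (admm k) => _ -> _; rewrite /residual /reduced scalerBr scalerA.
rewrite mulVf ?gt_eqF // scale1r.
by apply/matrixP => i j; rewrite !mxE; ring.
Qed.

(** The optimality conditions of the two minimizations bound the gap by
- eta <w+ - w', w+ - w>, where w, w+ and w' are the reduced variables of the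
old, the new and the reference point. *)
Lemma lagrangian_step k u v mu (fu gv : R) : f u = fu%:E -> g v = gv%:E ->
  fine (f (x k.+1)) + fine (g (y k.+1))
    - dot mu (residual (x k.+1) (y k.+1))
    - (fu + gv - dot (l k.+1) (residual u v)) <=
  eta / 2 * (sqnorm2 (reduced (x k) (l k) - reduced u mu)
             - sqnorm2 (reduced (x k.+1) (l k.+1) - reduced u mu)).
Proof.
move=> fE gE.
have [ymin lE xmin] := admm k.
have rhoE w : A *m x k + B *m w - b = B *m w + (A *m x k - b).
  by rewrite addrAC addrC.
have := argmin_subgradient g_proper g_convex (ltW eta_gt0) rhoE ymin v.
have {}rhoE w : A *m w + B *m y k.+1 - b = A *m w + (B *m y k.+1 - b).
  by rewrite addrA.
have := argmin_subgradient f_proper f_convex (ltW eta_gt0) rhoE xmin u.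
rewrite -lE -(fineK (admm_fin_num k).1) -(fineK (admm_fin_num k).2) fE gE.
rewrite -!EFinD !lee_fin -/(residual _ _).
set r := residual (x k.+1) (y k.+1).
set dA := A *m (u - x k.+1); set dB := B *m (v - y k.+1) => fsub gsub.
have -> : residual u v = r + dA + dB.
  rewrite /r /dA /dB /residual !mulmxBr.
  by apply/matrixP => i j; rewrite !mxE; ring.
have := three_point (reduced (x k.+1) (l k.+1)) (reduced (x k) (l k))
  (reduced u mu).
rewrite -residualE -/r -(ler_pM2l eta_gt0) [leRHS]mulrCA.
have -> : eta * dot (reduced (x k.+1) (l k.+1) - reduced u mu) r =
    - (eta * dot dA r) - (dot (l k.+1) r - dot mu r).
  rewrite /dA /reduced !mulmxBr !dotE; field.
  by rewrite gt_eqF.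
clearbody r dA dB; move: fsub gsub; rewrite !dotE (dotC r dA).
move: (sqnorm2 _) (sqnorm2 _) => s1 s2 fsub gsub.
lra.
Qed.

Lemma residual_ergodic_mean k : (0 < k)%N ->
  residual (ergodic_mean x k) (ergodic_mean y k) =
  ergodic_mean (fun i => residual (x i) (y i)) k.
Proof.
move=> k0; rewrite /residual !ergodic_mean_mul ergodic_meanD.
by rewrite -{1}(ergodic_mean_cst (- b) k0) ergodic_meanD.
Qed.

(** Convexity of L in (x, y) and affinity in the multiplier bound the gap at
the ergodic means by the mean of the gaps at the iterates, whose bounds
telescope. *)
Lemma lagrangian_ergodic_gap k u v mu : (0 < k)%N ->
  (Lagrangian f g A B b (ergodic_mean x k) (ergodic_mean y k) mu
     - Lagrangian f g A B b u v (ergodic_mean l k)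
   <= (eta * sqnorm2 (reduced u mu - reduced (x 0) (l 0)) / (2 * k%:R))%:E)%E.
Proof.
move=> k0.
have kn0 : k%:R != 0 :> R by rewrite pnatr_eq0 -lt0n.
have [fN _] := f_proper; have [gN _] := g_proper.
rewrite [X in (_ - X <= _)%E]/Lagrangian.
(* If f u or g v is infinite, then the left-hand side is -oo. *)
case fE : (f u) (fN u) => [fu| |] // _; last first.
  by case: (g v) (gN v) => [gv| |] // _; rewrite !addye //= addeNy leNye.
case gE : (g v) (gN v) => [gv| |] // _; last by rewrite addeNy leNye.
have fmean : (f (ergodic_mean x k) <=
    (k%:R^-1 * \sum_(1 <= i < k.+1) fine (f (x i)))%:E)%E.
  by apply: econvex_ergodic_mean => // -[|i] // _; rewrite fineK ?admm_fin_num.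
have gmean : (g (ergodic_mean y k) <=
    (k%:R^-1 * \sum_(1 <= i < k.+1) fine (g (y i)))%:E)%E.
  by apply: econvex_ergodic_mean => // -[|i] // _; rewrite fineK ?admm_fin_num.
rewrite -!EFinD leeBlDr // /Lagrangian leeBlDr //.
apply: le_trans (leeD fmean gmean) _; rewrite -!EFinD lee_fin.
rewrite -!/(residual _ _) residual_ergodic_mean // dotC !dot_ergodic_mean.
pose w i := sqnorm2 (reduced (x i) (l i) - reduced u mu).
have gap : \sum_(1 <= i < k.+1) (fine (f (x i)) + fine (g (y i))
      - dot mu (residual (x i) (y i))
      - (fu + gv - dot (residual u v) (l i))) <= eta / 2 * (w 0%N - w k).
  rewrite big_add1 /= -opprB -(telescope_sumr w (leq0n k)) mulrN mulr_sumr.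
  rewrite -sumrN; apply: ler_sum => i _.
  rewrite (dotC (residual u v)) -mulrN [- (w _ - _)]opprB.
  exact: lagrangian_step.
have w0E : sqnorm2 (reduced u mu - reduced (x 0) (l 0)) = w 0%N.
  by rewrite /w -opprB /sqnorm2 dotNl dotNr opprK.
rewrite w0E; move: gap.
rewrite !sumrB sumr_const_nat big_split /= subn1 /= -[(fu + gv) *+ k]mulr_natr.
move: (bigop _ _ _) (bigop _ _ _) (bigop _ _ _) (bigop _ _ _) => s1 s2 s3 s4.
move=> gap; rewrite -subr_ge0.
rewrite [leRHS](_ : _ = k%:R^-1 *
    (eta / 2 * w 0%N - (s4 + s3 - s2 - ((fu + gv) * k%:R - s1)))); last first.
  by field.
rewrite mulr_ge0 ?invr_ge0 // subr_ge0; apply: le_trans gap _.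
by rewrite ler_wpM2l ?gerBl ?sqnorm2_ge0 // divr_ge0 // ltW.
Qed.

End ADMMStep.

(** * The ergodic rate *)

Theorem corollary3 (R : realType) (n p m : nat)
    (f : 'cV[R]_n -> \bar R) (g : 'cV[R]_p -> \bar R)
    (A : 'M[R]_(m, n)) (B : 'M[R]_(m, p)) (b : 'cV[R]_m) (eta : R)
    (x : nat -> 'cV[R]_n) (y : nat -> 'cV[R]_p) (l : nat -> 'cV[R]_m)
    (f_proper : proper_efun f) (f_lsc : lower_semicontinuous f)
    (f_convex : econvex f)
    (g_proper : proper_efun g) (g_lsc : lower_semicontinuous g)
    (g_convex : econvex g)
    (eta_gt0 : 0 < eta)
    (admm : ADMM f g A B b eta x y l) :
  (forall k : nat, (1 <= k)%N ->
   forall (y' : 'cV[R]_p) (x' : 'cV[R]_n) (l' : 'cV[R]_m),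
     (Lagrangian f g A B b (ergodic_mean x k) (ergodic_mean y k) l'
        - Lagrangian f g A B b x' y' (ergodic_mean l k)
      <= (sqnormP (Pmx p A eta)
            (zvec y' x' l' - zvec (y 0%N) (x 0%N) (l 0%N))
          / (2 * k%:R))%:E)%E)
  /\
  (forall (xs : 'cV[R]_n) (ys : 'cV[R]_p) (Fs : \bar R),
     is_argmin [set w : 'cV[R]_n * 'cV[R]_p | A *m w.1 + B *m w.2 = b]
       (fun w => f w.1 + g w.2)%E (xs, ys) ->
     Fs = (f xs + g ys)%E ->
   forall k : nat, (1 <= k)%N ->
   forall l' : 'cV[R]_m,
     (f (ergodic_mean x k) + g (ergodic_mean y k)
        - (dot l' (A *m ergodic_mean x k + B *m ergodic_mean y k - b))%:E - Fs
      <= (sqnormP (Pmx p A eta)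
            (zvec ys xs l' - zvec (y 0%N) (x 0%N) (l 0%N))
          / (2 * k%:R))%:E)%E).
Proof.
have gap := lagrangian_ergodic_gap f_proper f_convex g_proper g_convex eta_gt0
  admm.
split=> [k k0 y' x' l'|xs ys Fs [feas _] -> k k0 l'].
  by rewrite sqnormP_zvec ?gt_eqF // gap.
have := gap k xs ys l' k0; rewrite sqnormP_zvec ?gt_eqF //.
(* At a feasible point the Lagrangian is the objective. *)
by rewrite [X in (_ - X <= _)%E]/Lagrangian feas subrr dot0r sube0.
Qed.
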